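(* The matroid $R_{10}$ satisfies $\mu(R_{10})=3$, $\gamma(R_{10})=4$, and $\eta(R_{10})=3$. In particular, $\mu(R_{10})=\eta(R_{10})$.
   Context: $R_{10}$ is the rank-$5$ binary matroid on $10$ elements represented over $GF(2)$ by the columns of $$\left[\begin{array}{ccccc|ccccc} 1&0&0&0&0&1&0&0&1&1\\ 0&1&0&0&0&1&1&0&0&1\\ 0&0&1&0&0&1&1&1&0&0\\ 0&0&0&1&0&0&1&1&1&0\\ 0&0&0&0&1&0&0&1&1&1 \end{array}\right].$$ (Equivalently, up to isomorphism, by the ten vectors of $GF(2)^5$ with exactly three nonzero entries.) A join of a matroid $M$ on ground set $E(M)$ is a set $J\subseteq E(M)$ with $|J\cap C|\le |C|/2$ for every circuit $C$ of $M$. $\mu(M)$ is the maximum size of a join. Ear decompositions: for a nonempty sequence of circuits $C_1,\dots,C_t$ of $M$ put $D_0=\varnothing$ and $D_i=C_1\cup\dots\cup C_i$. The sequence is an ear decomposition of $M$ if $D_t=E(M)$ and for every $i\ge 2$: (E1) $C_i\cap D_{i-1}\neq\varnothing$; (E2) $C_i\setminus D_{i-1}\ne\varnothing$; (E3) no circuit $C$ of $M$ with $C\cap D_{i-1}\neq\varnothing$ and $C\setminus D_{i-1}\neq\varnothing$ has $C\setminus D_{i-1}$ properly contained in $C_i\setminus D_{i-1}$. The set $P_i=C_i\setminus D_{i-1}$ is the $i$th lobe; it is odd or even according to the parity of $|P_i|$. $\varphi(M)$ is the minimum number of even lobes and $\gamma(M)$ the maximum number of odd lobes over all ear decompositions of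 $M$. For a connected matroid $M$ not isomorphic to $U_{1,1}$ (the one-element rank-$1$ uniform matroid), an ear decomposition exists, every ear decomposition has $|E(M)|-r(M)$ lobes, and $\eta(M):=\frac{r(M)+\varphi(M)}{2}=\frac{|E(M)|-\gamma(M)}{2}$, where $r(M)$ is the rank. *)

(* Defs.v *)
From mathcomp Require Import all_boot all_order all_algebra.

Set Implicit Arguments.
Unset Strict Implicit.
Unset Printing Implicit Defensive.

Import Order.TTheory GRing.Theory Num.Theory.

(* Finite matroids on the ground set [set: T], given by independent sets. *)
Record matroid (T : finType) := Matroid {
  indep :> pred {set T};
  indep0 : indep set0;
  indepS : forall A B : {set T}, A \subset B -> indep B -> indep A;
  indep_aug : forall A B : {set T}, indep A -> indep B -> #|A| < #|B| ->
    exists2 x, x \in B :\: A & indep (x |: A)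
}.

Section MatroidInvariants.

Variables (T : finType) (M : matroid T).
Implicit Types (C D J : {set T}) (s : seq {set T}).

Definition rank : nat := \max_(A : {set T} | indep M A) #|A|.

Definition circuit C : bool := minset (fun A => ~~ indep M A) C.

Definition join J : bool :=
  [forall C, circuit C ==> (2 * #|J :&: C| <= #|C|)].

Definition mu : nat := \max_(J : {set T} | join J) #|J|.

(* Conditions (E1), (E2), (E3) for adding the circuit C to the union D of the
   earlier circuits. *)
Definition ear D C : bool :=
  [&& C :&: D != set0, C :\: D != set0
    & [forall C' : {set T},
        [&& circuit C', C' :&: D != set0 & C' :\: D != set0]
        ==> ~~ (C' :\: D \proper C :\: D)]].

(* The sequence C_1, ..., C_t is s, so C_(i+1) is [nth set0 s i], and
   [ear_union s i] is D_i, the union of the first i circuits. *)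
Definition ear_union s (i : nat) : {set T} := \bigcup_(C <- take i s) C.

Definition ear_decomposition s : bool :=
  [&& s != [::], all circuit s, ear_union s (size s) == [set: T]
    & [forall i : 'I_(size s), (0 < i) ==> ear (ear_union s i) (nth set0 s i)]].

(* The lobes P_1, ..., P_t, the first one being C_1 itself. *)
Definition lobes s : seq {set T} :=
  [seq nth set0 s i :\: ear_union s i | i <- iota 0 (size s)].

Definition odd_lobes s : nat := count (fun P : {set T} => odd #|P|) (lobes s).
Definition even_lobes s : nat := count (fun P : {set T} => ~~ odd #|P|) (lobes s).

(* Ear decompositions have at most #|T| terms (ear_decomposition_size), so
   quantifying over the finite type of sequences of size at most #|T| loses
   none of them. *)
Definition gamma : nat :=
  \max_(s : #|T|.-bseq {set T} | ear_decomposition s) odd_lobes s.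

(* The default value #|T| only matters when there is no ear decomposition:
   see phi_attained. *)
Definition phi : nat :=
  \big[minn/#|T|]_(s : #|T|.-bseq {set T} | ear_decomposition s) even_lobes s.

Definition eta : rat := ((rank + phi)%:R / 2)%R.

Lemma circuit_neq0 C : circuit C -> C != set0.
Proof.
case/minsetP=> depC _; apply: contraNneq depC => ->; exact: indep0.
Qed.

Lemma ear_decomposition_size s : ear_decomposition s -> size s <= #|T|.
Proof.
case/and4P=> _ /allP cs _ /forallP es.
suff H i : i <= size s -> i <= #|ear_union s i|.
  by apply: leq_trans (H _ (leqnn _)) (max_card _).
elim: i => [//|i IHi] lti.
have eqU : ear_union s i.+1 = nth set0 s i :|: ear_union s i.
  by rewrite /ear_union (take_nth set0) // -cats1 big_cat big_seq1 setUC.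
apply: leq_ltn_trans (IHi (ltnW lti)) _; rewrite eqU.
apply: proper_card; rewrite properE subsetUr /= subUset subxx andbT.
rewrite -setD_eq0; case: (posnP i) => [i0 | i_gt0].
  by rewrite i0 /ear_union take0 big_nil setD0 circuit_neq0 // cs // mem_nth -?i0.
by have /implyP/(_ i_gt0)/and3P[] := es (Ordinal lti).
Qed.

Lemma gamma_ub s : ear_decomposition s -> odd_lobes s <= gamma.
Proof.
move=> es; exact: (leq_bigmax_cond (Bseq (ear_decomposition_size es))).
Qed.

Lemma gamma_attained s : ear_decomposition s ->
  exists2 s', ear_decomposition s' & gamma = odd_lobes s'.
Proof.
move=> es; pose P := [pred b : #|T|.-bseq {set T} | ear_decomposition b].
have P_gt0 : 0 < #|P|.
  by apply/card_gt0P; exists (Bseq (ear_decomposition_size es)).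
by have [b Pb gE] := eq_bigmax_cond (fun b : #|T|.-bseq _ => odd_lobes b) P_gt0; exists b.
Qed.

Lemma phi_lb s : ear_decomposition s -> phi <= even_lobes s.
Proof.
move=> es; rewrite /phi; set b0 := Bseq (ear_decomposition_size es).
have: b0 \in index_enum _ by rewrite mem_index_enum.
elim: (index_enum _) => // b r IHr; rewrite inE big_cons => /predU1P[<-|/IHr le_r].
  by rewrite es geq_minl.
by case: ifP => // _; apply: leq_trans (geq_minr _ _) le_r.
Qed.

Lemma phi_attained s : ear_decomposition s ->
  exists2 s', ear_decomposition s' & phi = even_lobes s'.
Proof.
move=> es.
have sizeE s' : ear_decomposition s' -> even_lobes s' <= #|T|.
  move=> es'; apply: leq_trans (count_size _ _) _.
  by rewrite size_map size_iota ear_decomposition_size.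
have: phi = #|T| \/ exists2 s', ear_decomposition s' & phi = even_lobes s'.
  rewrite /phi; elim/big_ind: _ => [|x y IHx IHy|b eb]; [by left| |by right; exists b].
  by rewrite /minn; case: ifP.
case=> // phiT; exists s => //; apply/eqP.
by rewrite eqn_leq phi_lb //= phiT sizeE.
Qed.

End MatroidInvariants.

Section VectorMatroid.

Variables (F : fieldType) (m n : nat) (A : 'M[F]_(m, n)).

Definition col_indep (S : {set 'I_n}) : bool := free [seq col j A | j in S].

Lemma col_indep0 : col_indep set0.
Proof. by rewrite /col_indep /image_mem enum_set0 nil_free. Qed.

Lemma col_indepS (S S' : {set 'I_n}) :
  S \subset S' -> col_indep S' -> col_indep S.
Proof.
move=> sSS'; rewrite /col_indep.
have /perm_free -> : perm_eq [seq col j A | j in S']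
    ([seq col j A | j in S] ++ [seq col j A | j in S' :\: S]).
  rewrite /image_mem -map_cat; apply: perm_map; apply: uniq_perm.
  - exact: enum_uniq.
  - rewrite cat_uniq !enum_uniq /= andbT; apply/hasPn => x.
    by rewrite !mem_enum inE => /andP[].
  - move=> x; rewrite mem_cat !mem_enum inE.
    by case: (boolP (x \in S)) => [/(subsetP sSS')|].
exact: catl_free.
Qed.

Lemma col_indepU1 (S : {set 'I_n}) x : x \notin S ->
  col_indep (x |: S)
  = (col x A \notin <<[seq col j A | j in S]>>%VS) && col_indep S.
Proof.
move=> xS; rewrite /col_indep -free_cons; apply: perm_free.
apply: (perm_map (fun j => col j A) (t := x :: enum S)); apply: uniq_perm.
- exact: enum_uniq.
- by rewrite /= enum_uniq mem_enum xS.
- by move=> y; rewrite inE !mem_enum in_setU1.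
Qed.

Lemma col_indep_aug (S S' : {set 'I_n}) :
  col_indep S -> col_indep S' -> #|S| < #|S'| ->
  exists2 x, x \in S' :\: S & col_indep (x |: S).
Proof.
move=> iS iS' ltSS'.
case: (boolP [exists x in S' :\: S, col_indep (x |: S)]) => [/exists_inP //|].
rewrite negb_exists_in => /forall_inP noaug.
suff: (<<[seq col j A | j in S']>> <= <<[seq col j A | j in S]>>)%VS.
  move/dimvS; move: (iS) (iS'); rewrite /col_indep => /eqP -> /eqP ->.
  by rewrite !size_image leqNgt ltSS'.
apply/span_subvP => _ /imageP[x xS' ->].
have [xS | xS] := boolP (x \in S); first by apply/memv_span/image_f.
have := noaug x; rewrite inE xS xS' => /(_ isT).
by rewrite col_indepU1 // iS andbT negbK.
Qed.

(* The matroid represented over F by the columns of A. *)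
Definition vector_matroid : matroid 'I_n :=
  Matroid col_indep0 col_indepS col_indep_aug.

End VectorMatroid.

Local Open Scope ring_scope.

Definition R10_rows : seq (seq nat) :=
  [:: [:: 1; 0; 0; 0; 0;  1; 0; 0; 1; 1];
      [:: 0; 1; 0; 0; 0;  1; 1; 0; 0; 1];
      [:: 0; 0; 1; 0; 0;  1; 1; 1; 0; 0];
      [:: 0; 0; 0; 1; 0;  0; 1; 1; 1; 0];
      [:: 0; 0; 0; 0; 1;  0; 0; 1; 1; 1]]%N.

Definition R10_mx : 'M['F_2]_(5, 10) :=
  \matrix_(i, j) (nth 0%N (nth [::] R10_rows i) j)%:R.

Definition R10 : matroid 'I_10 := vector_matroid R10_mx.

(* Main.v *)
Require Import Defs.
From mathcomp Require Import all_boot all_order all_algebra.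
From mathcomp Require Import zify.

(** Two facts about an ear decomposition bound the numbers of its lobes.
    Each ear raises the nullity |D| - r(D) of the union of the circuits
    (indep_nullity_ear), so a matroid M has at most |E(M)| - r(M) lobes
    (ear_rank_le); for R10 this is 10 - 5 = 5.  The first lobe is a circuit,
    and the circuits of R10 are even because every column of the matrix has an
    odd number of ones.  So there is at least one even lobe, and at most four
    are odd.  Contracting the circuit {0,1,2,5} leaves a rank 2 binary matroid
    on six elements with parallel classes {3,6}, {4,9}, {7,8}; the
    transversal {3,4,7} is a circuit of it, and can be taken as the second lobe.
    The three elements left after that are lobes of size 1.  The lobes of
    this decomposition have sizes 4, 3, 1, 1, 1, so that gamma = 4 and phi = 1.
    Its length also gives r(R10) <= 5, whence eta = (5 + 1) / 2 = 3.

    The upper bound on mu is a second moment argument, valid for any binary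
    matroid on n elements in which the ground set is a cycle (a disjoint union
    of circuits, that is, a zero-sum set of columns) and any two elements
    are separated by a cycle.  Let J be a join and let S run over the cycles.
    Since J takes at most half of S, the symmetric difference of J and S has at
    least |J| elements; applied to the complement of S, which is a cycle too,
    this says that it has at most n - |J| elements.  Hence the sum g(S) of the
    signs of the elements, - inside the symmetric difference and + outside,
    satisfies |g(S)| <= n - 2|J|.  On the other hand, for a uniformly random S
    the signs of two distinct elements are uncorrelated: adding a cycle that
    separates the two elements permutes the cycles and negates the product of
    the signs.  So g(S)^2 has mean n, and n <= (n - 2|J|)^2
    (join_second_moment).  For n = 10 this forces |J| <= 3.  Conversely
    {0,1,3} is a join: circuits have 4 or more elements, and no circuit of size
    4 contains it. *)

Set Implicit Arguments.
Unset Strict Implicit.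
Unset Printing Implicit Defensive.

Import Order.TTheory GRing.Theory Num.Theory.

(** * Ear decompositions and nullity *)

Section Ears.
Variables (T : finType) (M : matroid T).
Implicit Types (C D I J : {set T}) (s : seq {set T}).

Lemma indep_circuitD1 C e : circuit M C -> e \in C -> indep M (C :\ e).
Proof.
case/minsetP=> _ minC eC; apply: contraT => depCe.
have /setP/(_ e) := minC _ depCe (subD1set C e).
by rewrite !inE eqxx eC.
Qed.

(** The augmentation axiom, iterated until I is as large as K. *)
Lemma indep_extend I K : indep M I -> indep M K -> #|I| <= #|K| ->
  exists L : {set T}, [/\ indep M L, I \subset L, L \subset I :|: K & #|K| <= #|L|].
Proof.
have [n] := ubnP (#|K| - #|I|); elim: n I => // n IHn I ltn iI iK.
rewrite leq_eqVlt => /predU1P[eqIK | ltIK].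
  by exists I; rewrite subxx subsetUl eqIK.
have [x /setDP[xK xI] ixI] := indep_aug iI iK ltIK.
have cxI : #|x |: I| = #|I|.+1 by rewrite cardsU1 xI.
have [||L [iL sIL sLK leKL]] := IHn _ _ ixI iK; [by lia | by rewrite cxI |].
exists L; split=> //; first by apply: subset_trans sIL; apply: subsetUr.
apply: (subset_trans sLK); rewrite -setUA subUset subxx andbT sub1set.
by rewrite inE xK orbT.
Qed.

(** An element e of C :\: D can be exchanged out of an independent set I: either
    C :\ e is already larger than I, or it grows inside C :|: I to an
    independent set as large as I, which avoids e since it cannot contain the
    whole of C.  Such a set misses e in addition to the k elements of D. *)
Lemma indep_nullity_ear C D I k : circuit M C -> C :\: D != set0 ->
    (forall K, indep M K -> K \subset D -> #|K| + k <= #|D|) ->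
  indep M I -> I \subset D :|: C -> #|I| + k.+1 <= #|D :|: C|.
Proof.
move=> circC /set0Pn[e eCD] boundD iI sI.
have /setDP[eC eD] := eCD.
have iCe := indep_circuitD1 circC eC.
suff [K [iK sK leIK eK]] : exists K : {set T},
    [/\ indep M K, K \subset D :|: C, #|I| <= #|K| & e \notin K].
  have leKD := boundD (K :&: D) (indepS (subsetIl _ _) iK) (subsetIr _ _).
  have ltKC : #|K :\: D| < #|C :\: D|.
    apply: proper_card; apply/properP; split; last first.
      by exists e => //; rewrite inE (negPf eK) andbF.
    apply/subsetP=> x /setDP[xK xD]; have /setUP[|xC] := subsetP sK x xK.
      by rewrite (negPf xD).
    by rewrite inE xD.
  have cK := cardsID D K; have cDC := cardsID D (D :|: C).
  have ED : (D :|: C) :&: D = D by apply/setIidPr/subsetUl.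
  have EC : (D :|: C) :\: D = C :\: D by rewrite setDUl setDv set0U.
  by rewrite ED EC in cDC; lia.
have [leCI | ltIC] := leqP #|C :\ e| #|I|; last first.
  exists (C :\ e); split=> //; first exact: subset_trans (subD1set _ _) (subsetUr _ _).
    exact: ltnW.
  by rewrite !inE eqxx.
have [K [iK sCK sK leIK]] := indep_extend iCe iI leCI.
exists K; split=> //.
  apply: (subset_trans sK); rewrite subUset sI andbT.
  exact: subset_trans (subD1set _ _) (subsetUr _ _).
apply: contraL iK => eK; have /minsetP[depC _] := circC.
by apply: contra depC; apply: indepS; rewrite -(setD1K eC) subUset sub1set eK.
Qed.

Lemma ear_unionS s i : i < size s ->
  ear_union s i.+1 = ear_union s i :|: nth set0 s i.
Proof. by move=> lti; rewrite /ear_union (take_nth set0) // -cats1 big_cat big_seq1. Qed.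

Lemma ear_nullity s i I : ear_decomposition M s -> i <= size s ->
  indep M I -> I \subset ear_union s i -> #|I| + i <= #|ear_union s i|.
Proof.
case/and4P=> _ /allP cs _ /forallP es; elim: i I => [|i IHi] I lti iI sI.
  by rewrite addn0 subset_leq_card.
rewrite ear_unionS // in sI *; have circC := cs _ (mem_nth set0 lti).
apply: (indep_nullity_ear circC) iI sI => [|K iK sK]; last exact: IHi (ltnW lti) iK sK.
case: (posnP i) => [-> | i_gt0]; last by have /implyP/(_ i_gt0)/and3P[] := es (Ordinal lti).
rewrite /ear_union take0 big_nil setD0 (circuit_neq0 (M := M)) // cs // mem_nth //.
exact: leq_ltn_trans lti.
Qed.

Lemma ear_rank_le s : ear_decomposition M s -> rank M + size s <= #|T|.
Proof.
move=> es; have [_ _ /eqP uT _] := and4P es.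
have iP : 0 < #|[pred A : {set T} | indep M A]| by apply/card_gt0P; exists set0; apply: indep0.
rewrite /rank; have [A iA ->] := eq_bigmax_cond (fun A : {set T} => #|A|) iP.
by have := ear_nullity es (leqnn _) iA; rewrite uT cardsT; apply; apply: subsetT.
Qed.

Lemma odd_even_lobes s : odd_lobes s + even_lobes s = size s.
Proof. by rewrite /odd_lobes /even_lobes count_predC size_map size_iota. Qed.

(** The first lobe is a whole circuit. *)
Lemma even_lobes_gt0 s : (forall C, circuit M C -> ~~ odd #|C|) ->
  ear_decomposition M s -> 0 < even_lobes s.
Proof.
move=> evenM; case: s => [|C s] /and4P[//] _ /andP[cC _] _ _.
by rewrite /even_lobes /lobes /= {1}/ear_union take0 big_nil setD0 evenM.
Qed.

(** A one-element lobe has no nonempty proper subset, so (E3) holds trivially. *)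
Lemma ear_of_card1 C D : C :&: D != set0 -> #|C :\: D| = 1 -> ear M D C.
Proof.
move=> CD card1; apply/and3P; split=> //; first by rewrite -card_gt0 card1.
apply/forallP=> C'; apply/implyP=> /and3P[_ _ C'D].
by apply: contra C'D => /proper_card; rewrite card1 ltnS leqn0 cards_eq0.
Qed.

End Ears.

(** * Cycles of binary matroids *)

Section Binary.
Variables (m n : nat) (A : 'M['F_2]_(m, n)).
Implicit Types (S C J : {set 'I_n}).
Local Open Scope ring_scope.

Definition cycle S : bool := \sum_(j in S) col j A == 0.

Lemma addvv_F2 (v : 'cV['F_2]_m) : v + v = 0.
Proof.
rewrite -(scale1r v) -scalerDl.
by have /eqP-> : 1 + 1 == 0 :> 'F_2 by []; rewrite scale0r.
Qed.

Definition symdiff S S' : {set 'I_n} := [set j | (j \in S) (+) (j \in S')].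

Lemma in_symdiff S S' j : (j \in symdiff S S') = (j \in S) (+) (j \in S').
Proof. by rewrite inE. Qed.

Lemma sum_symdiff S S' : \sum_(j in symdiff S S') col j A
  = \sum_(j in S) col j A + \sum_(j in S') col j A.
Proof.
rewrite [LHS]big_mkcond [X in X + _]big_mkcond [X in _ + X]big_mkcond -big_split /=.
apply: eq_bigr => j _; rewrite in_symdiff.
by do 2 case: (_ \in _); rewrite /= ?addvv_F2 ?addr0 ?add0r.
Qed.

Lemma cycle0 : cycle set0. Proof. by rewrite /cycle big_set0. Qed.

Lemma cycle_symdiff S S' : cycle S' -> cycle (symdiff S S') = cycle S.
Proof. by rewrite /cycle sum_symdiff => /eqP->; rewrite addr0. Qed.

Lemma symdiffK S : cancel (symdiff^~ S) (symdiff^~ S).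
Proof. by move=> S'; apply/setP=> j; rewrite !in_symdiff -addbA addbb addbF. Qed.

Lemma symdiff_sub S S' : S' \subset S -> symdiff S S' = S :\: S'.
Proof.
move/subsetP=> sS; apply/setP=> j; rewrite in_symdiff inE.
by case: (boolP (j \in S')) => [/sS->|]; case: (j \in S).
Qed.

(** Over the two-element field a linear relation is determined by its support. *)
Lemma col_indepP S : reflect
  (forall S', S' \subset S -> cycle S' -> S' = set0) (col_indep A S).
Proof.
have EX (k : 'I_n -> 'F_2) : \sum_(i < #|S|) k (enum_val i) *: [seq col j A | j in S]`_i
    = \sum_(j in S) k j *: col j A.
  rewrite [RHS]big_enum_val; apply: eq_bigr => i _; congr (_ *: _).
  rewrite (nth_map (enum_val i)) -?cardE //; congr (col _ A).
  by rewrite -enum_val_nth.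
apply: (iffP idP) => [/(@freeP _ _ _ [tuple of image _ S]) /= freeS S' sS' cycS' | noS].
  apply/setP=> j; rewrite in_set0; apply/negP=> jS'; have jS := subsetP sS' j jS'.
  pose k i : 'F_2 := (i \in S')%:R.
  have /eqP : k j = 0; last by rewrite /k jS'.
  rewrite -(enum_rankK_in jS jS); apply: (freeS (fun i => k (enum_val i))).
  rewrite EX -[RHS](eqP cycS') [LHS](bigID (mem S')) /= [X in _ + X]big1 ?addr0 => [|i].
    rewrite (eq_bigl (mem S')) => [|i]; first by apply: eq_bigr => i /= iS'; rewrite /k iS' scale1r.
    by rewrite inE /=; case: (boolP (i \in S')) => [/(subsetP sS')-> | _]; rewrite ?andbF.
  by case/andP=> _ /negPf iS'; rewrite /k iS' scale0r.
(* The support of a nontrivial relation k is a nonempty cycle. *)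
apply/(@freeP _ _ _ [tuple of image _ S]) => /= k k0 i0.
apply/eqP; apply: contraT => ki0.
pose S' := [set enum_val i | i in [pred i | k i != 0]].
have sS' : S' \subset S by apply/subsetP=> _ /imsetP[i _ ->]; apply: enum_valP.
suff /(noS _ sS')/setP/(_ (enum_val i0)) : cycle S'.
  by rewrite in_set0 imset_f.
rewrite /cycle big_imset /=; last by move=> i j _ _; apply: enum_val_inj.
rewrite big_mkcond -[X in _ == X]k0; apply/eqP/eq_bigr => i _.
rewrite (nth_map (enum_val i)) -?cardE // -enum_val_nth inE.
have [-> | ki] := eqVneq (k i) 0; first by rewrite scale0r.
by have -> : k i = 1; [case: (k i) ki => [[|[|]]] // p _; apply/val_inj | rewrite scale1r].
Qed.

Lemma circuitP C : reflect
  [/\ cycle C, C != set0 & forall S, S \subset C -> cycle S -> S != set0 -> S = C]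
  (circuit (vector_matroid A) C).
Proof.
have depP S : ~~ col_indep A S -> exists S', [/\ S' \subset S, cycle S' & S' != set0].
  move=> depS.
  suff /existsP[S' /and3P[sS' cS' S'0]] :
      [exists S' : {set 'I_n}, [&& S' \subset S, cycle S' & S' != set0]] by exists S'.
  apply: contraR depS => /existsPn noS.
  apply/col_indepP=> S' sS cS; apply/eqP; apply: contraT => S0.
  by have := noS S'; rewrite sS cS S0.
have cyc_dep S : cycle S -> S != set0 -> ~~ col_indep A S.
  by move=> cS; apply: contra => /col_indepP/(_ S (subxx _) cS)->.
apply: (iffP idP) => [/minsetP[/depP[S [sS cS S0]] minC] | [cC C0 minC]].
  have ES := minC S (cyc_dep _ cS S0) sS; rewrite -{1 2}ES; split=> // S' sS' cS' S'0.
  exact: minC (cyc_dep _ cS' S'0) sS'.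
apply/minsetP; split=> [|S depS sS]; first exact: cyc_dep.
have [S' [sS' cS' S'0]] := depP S depS.
by apply/eqP; rewrite eqEsubset sS -(minC S') // (subset_trans sS').
Qed.

Lemma cycle_circuit S : cycle S -> S != set0 ->
  exists2 C : {set 'I_n}, C \subset S & circuit (vector_matroid A) C.
Proof.
move=> cS S0; have depS : ~~ col_indep A S.
  by apply: contra S0 => /col_indepP/(_ S (subxx _) cS)->.
have [C minC sC] := @minset_exists _ (fun S => ~~ col_indep A S) S depS.
by exists C.
Qed.

(** A cycle is a disjoint union of circuits: remove a circuit from it, and what
    remains is again a cycle. *)
Lemma join_cycle J S : join (vector_matroid A) J -> cycle S ->
  (2 * #|J :&: S| <= #|S|)%N.
Proof.
move/forallP=> joinJ; have [k] := ubnP #|S|; elim: k S => // k IHk S ltS cS.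
have [-> | S0] := eqVneq S set0; first by rewrite setI0 cards0.
have [C sC circC] := cycle_circuit cS S0.
have /implyP/(_ circC) leC := joinJ C; have /circuitP[cC C0 _] := circC.
have := IHk (S :\: C); rewrite -(symdiff_sub sC) cycle_symdiff // symdiff_sub //.
have cSC := cardsID C S; have cJC := cardsID C (J :&: S).
rewrite (setIidPr sC) in cSC; rewrite -setIA (setIidPr sC) -setIDA in cJC.
have : (0 < #|C|)%N by rewrite card_gt0.
by move=> C_gt0 /(_ _ cS); lia.
Qed.

(** * A second moment bound on joins *)

Lemma card_symdiff S S' : (#|symdiff S S'| + 2 * #|S :&: S'| = #|S| + #|S'|)%N.
Proof.
have -> : symdiff S S' = (S :\: S') :|: (S' :\: S).
  by apply/setP=> j; rewrite !inE; do 2 case: (_ \in _).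
rewrite cardsU -(cardsID S' S) -(cardsID S S') [S' :&: S]setIC.
have -> : (S :\: S') :&: (S' :\: S) = set0.
  by apply/setP=> j; rewrite !inE; do 2 case: (_ \in _).
by rewrite cards0; lia.
Qed.

Lemma card_symdiff_join J S : join (vector_matroid A) J -> cycle S ->
  (#|J| <= #|symdiff J S|)%N.
Proof. by move=> jJ cS; have := join_cycle jJ cS; have := card_symdiff J S; lia. Qed.

Lemma sum_sign_set S : \sum_j (-1) ^+ (j \in S) = n%:R - 2 * #|S|%:R :> int.
Proof.
under eq_bigr => j _.
  have -> : (-1) ^+ (j \in S) = 1 - 2 * (j \in S)%:R :> int by case: (_ \in _).
  over.
rewrite sumrB -mulr_sumr sumr_const card_ord -natr_sum -sum1_card [X in _ = _ - 2 * X%:R]big_mkcond.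
by congr (_ - 2 * _%:R); apply: eq_bigr => j _; case: (_ \in _).
Qed.

(** Translation by C permutes the cycles and negates the product of the signs of
    i and j, because C contains exactly one of them. *)
Lemma sum_sign_cycles J i j C : cycle C -> (i \in C) != (j \in C) ->
  \sum_(S | cycle S) (-1) ^+ (i \in symdiff J S) * (-1) ^+ (j \in symdiff J S) = 0 :> int.
Proof.
move=> cC ijC; set X := \sum_(S | _) _; suff : X = - X by lia.
rewrite {1}/X (reindex_inj (can_inj (symdiffK C))) -sumrN.
apply: eq_big => [S | S _]; first exact: cycle_symdiff.
by rewrite !in_symdiff; move: ijC; do 6 case: (_ \in _).
Qed.

(** The sum over the cycles S of the squared sign sum is N * n, where N is the
    number of cycles: the off-diagonal terms vanish by sum_sign_cycles.  Each of
    these squares is at most (n - 2 * #|J|) ^ 2.  The truncated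
    subtraction is harmless: a join has at most half of the cycle setT. *)
Lemma join_second_moment J : join (vector_matroid A) J -> cycle [set: 'I_n] ->
    (forall i j, i != j -> exists2 C, cycle C & (i \in C) != (j \in C)) ->
  (n <= (n - 2 * #|J|) ^ 2)%N.
Proof.
move=> jJ cT sep; set N := #|[pred S | cycle S]|.
have N_gt0 : (0 < N)%N by apply/card_gt0P; exists set0; apply: cycle0.
pose x i S : int := (-1) ^+ (i \in symdiff J S).
have moment2 : \sum_(S | cycle S) (\sum_i x i S) ^+ 2 = (N * n)%:R.
  under eq_bigr => S _ do rewrite expr2 mulr_suml.
  rewrite exchange_big /=.
  transitivity (\sum_(i < n) N%:R : int); last first.
    by rewrite sumr_const card_ord mulrnA.
  apply: eq_bigr => i _; under eq_bigr => S _ do rewrite mulr_sumr.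
  rewrite exchange_big (bigD1 i) //= [X in _ + X]big1 ?addr0 => [|j ji].
    by rewrite (eq_bigr (fun=> 1)) ?sumr_const // => S _; rewrite -expr2 sqrr_sign.
  have [C cC ijC] := sep j i ji; apply: (sum_sign_cycles J cC).
  by rewrite eq_sym.
have bound S : cycle S -> (\sum_i x i S) ^+ 2 <= ((n - 2 * #|J|) ^ 2)%N%:R.
  move=> cS; rewrite sum_sign_set.
  have le1 := card_symdiff_join jJ cS.
  (* The complement of S is a cycle, which gives the lower bound on the sum. *)
  have := card_symdiff_join jJ (etrans (cycle_symdiff S cT) cS).
  have -> : symdiff J (symdiff S setT) = ~: symdiff J S.
    by apply/setP=> k; rewrite !inE; do 2 case: (_ \in _).
  have := cardsC (symdiff J S); rewrite card_ord => cardC le2.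
  by rewrite natrX -subr_ge0 subr_sqr mulr_ge0 //; lia.
have : (N * n)%:R <= (N * (n - 2 * #|J|) ^ 2)%:R :> int.
  rewrite -moment2; apply: le_trans (ler_sum _ bound) _.
  by rewrite sumr_const natrM mulr_natl.
by rewrite ler_nat leq_pmul2l.
Qed.

End Binary.

(** * Cycles of R10 *)

Notation elt k := (inord k : 'I_10).

(** Subsets of the ground set are listed by the values of their elements, so that
    statements about explicit sets reduce to computations on lists. *)
Definition eset (l : seq nat) : {set 'I_10} := [set j | val j \in l].

Lemma in_eset l k : k < 10 -> (elt k \in eset l) = (k \in l).
Proof. by move=> lt10; rewrite inE /= inordK. Qed.

Lemma big_ord10 (R : nmodType) (F : 'I_10 -> R) :
  (\sum_j F j = \sum_(k <- iota 0 10) F (elt k))%R.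
Proof.
rewrite -[iota 0 10]/(index_iota 0 10) big_mkord.
by apply: eq_bigr => j _; rewrite inord_val.
Qed.

Lemma card_ord10 (S : {set 'I_10}) : #|S| = \sum_(k <- iota 0 10) (elt k \in S).
Proof.
rewrite -sum1_card big_mkcond -(big_ord10 (fun j => (j \in S) : nat)).
by apply: eq_bigr => j _; case: (_ \in _).
Qed.

Lemma card_eset l : #|eset l| = count (mem l) (iota 0 10).
Proof.
rewrite card_ord10 -sum1_count [RHS]big_mkcond; apply: eq_big_seq => k.
by rewrite mem_iota => k10; rewrite in_eset //=; case: (_ \in _).
Qed.

Lemma natr_F2_eq0 k : (k%:R == 0 :> 'F_2)%R = ~~ odd k.
Proof. by rewrite -(dvdn_pcharf (pchar_Fp (isT : prime 2))) dvdn2. Qed.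

(** The first five columns form the identity matrix, so row i of the system
    gives the i-th bit of a cycle in terms of its last five bits.  In
    particular there are 32 cycles, one for each choice of the last five bits. *)
Lemma R10_cycleP (S : {set 'I_10}) : reflect
  [/\ (elt 0 \in S) = (elt 5 \in S) (+) (elt 8 \in S) (+) (elt 9 \in S),
      (elt 1 \in S) = (elt 5 \in S) (+) (elt 6 \in S) (+) (elt 9 \in S),
      (elt 2 \in S) = (elt 5 \in S) (+) (elt 6 \in S) (+) (elt 7 \in S),
      (elt 3 \in S) = (elt 6 \in S) (+) (elt 7 \in S) (+) (elt 8 \in S)
    & (elt 4 \in S) = (elt 7 \in S) (+) (elt 8 \in S) (+) (elt 9 \in S)]
  (cycle R10_mx S).
Proof.
have -> : cycle R10_mx S = all (fun r => ~~ odd (\sum_(k <- iota 0 10)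
    (elt k \in S) * nth 0 r k)) R10_rows.
  rewrite /cycle; apply/eqP/(all_nthP [::]) => [S0 i lti | even_r].
    have /matrixP/(_ (Ordinal lti) ord0) := S0; rewrite summxE mxE big_mkcond big_ord10.
    move/eqP; rewrite -natr_F2_eq0 natr_sum; congr (_ == _).
    apply: eq_big_seq => k; rewrite mem_iota => k10.
    by rewrite !mxE /= inordK //; case: (_ \in _); rewrite ?mul1n ?mul0n.
  apply/matrixP=> i j; rewrite summxE mxE big_mkcond big_ord10; apply/eqP.
  have := even_r i (ltn_ord i); rewrite -natr_F2_eq0 natr_sum; congr (_ == _).
  apply: eq_big_seq => k; rewrite mem_iota => k10.
  by rewrite !mxE /= inordK //; case: (_ \in _); rewrite ?mul1n ?mul0n.
rewrite /= !big_cons !big_nil /= !(muln0, muln1, addn0, add0n) !oddD !oddb.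
set b0 := elt 0 \in S; set b1 := elt 1 \in S; set b2 := elt 2 \in S.
set b3 := elt 3 \in S; set b4 := elt 4 \in S; set b5 := elt 5 \in S.
set b6 := elt 6 \in S; set b7 := elt 7 \in S; set b8 := elt 8 \in S.
set b9 := elt 9 \in S.
clearbody b0 b1 b2 b3 b4 b5 b6 b7 b8 b9.
apply: (iffP idP).
  by case: b5 b6 b7 b8 b9 => -[] [] [] []; case: b0 b1 b2 b3 b4 => -[] [] [] [].
by case=> -> -> -> -> ->; case: b5 b6 b7 b8 b9 => -[] [] [] [].
Qed.

Lemma R10_cycle_eset l : cycle R10_mx (eset l) =
  [&& (0 \in l) == (5 \in l) (+) (8 \in l) (+) (9 \in l),
      (1 \in l) == (5 \in l) (+) (6 \in l) (+) (9 \in l),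
      (2 \in l) == (5 \in l) (+) (6 \in l) (+) (7 \in l),
      (3 \in l) == (6 \in l) (+) (7 \in l) (+) (8 \in l)
    & (4 \in l) == (7 \in l) (+) (8 \in l) (+) (9 \in l)].
Proof.
apply/R10_cycleP/and5P; rewrite !in_eset // => -[H0 H1 H2 H3 H4].
  by split; apply/eqP.
by split; apply/eqP.
Qed.

(** A check of the 32 cycles: they have 0, 4, 6 or 10 elements. *)
Lemma R10_cycle_card S : cycle R10_mx S ->
  ~~ odd #|S| /\ (S != set0 -> 3 < #|S|).
Proof.
rewrite -card_gt0 card_ord10 !big_cons !big_nil => /R10_cycleP[-> -> -> -> ->].
by do 5 case: (_ \in S).
Qed.

(** The sum of columns 0, 1 and 3 is not a column, so no cycle of size 4
    contains these three elements; this is again checked on the 32 cycles. *)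
Lemma R10_join013 : join R10 (eset [:: 0; 1; 3]).
Proof.
apply/forallP=> C; apply/implyP=> /circuitP[cC _ _]; move: cC.
rewrite !card_ord10; under [X in 2 * X]eq_bigr do rewrite inE.
rewrite !big_cons !big_nil !in_eset //= => /R10_cycleP[-> -> -> -> ->].
by do 5 case: (_ \in C).
Qed.

(** A proper nonempty cycle inside it would have at most 3 elements. *)
Lemma R10_circuit4 l : cycle R10_mx (eset l) -> #|eset l| = 4 -> circuit R10 (eset l).
Proof.
move=> cl card4; apply/circuitP; split=> // [|S sS cS S0]; first by rewrite -card_gt0 card4.
apply/eqP; rewrite eqEcard sS card4.
by have [_ /(_ S0)] := R10_cycle_card cS.
Qed.

Lemma R10_circuit_even C : circuit R10 C -> ~~ odd #|C|.
Proof. by case/circuitP=> cC _ _; have [] := R10_cycle_card cC. Qed.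

(** Each of columns 5, 6, 7, 8, 9 together with the three unit columns that sum
    to it: these five circuits are a basis of the cycle space.  In this order they are the
    circuits of an ear decomposition with lobes {0,1,2,5}, {3,4,7}, {6}, {8},
    {9}. *)
Definition R10_base : seq (seq nat) :=
  [:: [:: 0; 1; 2; 5]; [:: 2; 3; 4; 7]; [:: 1; 2; 3; 6]; [:: 0; 3; 4; 8]; [:: 0; 1; 4; 9]].

Lemma R10_base_cycle l : l \in R10_base -> cycle R10_mx (eset l).
Proof. by move: l; apply/allP; rewrite /= !R10_cycle_eset. Qed.

Lemma R10_base_separates (i j : 'I_10) : i != j ->
  exists2 C, cycle R10_mx C & (i \in C) != (j \in C).
Proof.
move=> ij; suff /hasP[l lB ijl] : has (fun l => (val i \in l) != (val j \in l)) R10_base.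
  by exists (eset l); [apply: R10_base_cycle | rewrite !inE].
have /allP/(_ (val i))/[!mem_iota]/(_ (ltn_ord i)) :
  all (fun i => all (fun j => (i != j) ==> has (fun l => (i \in l) != (j \in l)) R10_base)
    (iota 0 10)) (iota 0 10) by [].
by move=> /allP/(_ (val j))/[!mem_iota]/(_ (ltn_ord j))/implyP; apply.
Qed.

(** * Joins of R10 *)

Lemma R10_mu : mu R10 = 3.
Proof.
apply/eqP; rewrite eqn_leq; apply/andP; split.
  apply/bigmax_leqP=> J jJ.
  suff : 10 <= (10 - 2 * #|J|) ^ 2.
    (* For #|J| > 3 the square on the right is at most 2 ^ 2. *)
    apply: contraLR; rewrite -!ltnNge => lt3J.
    by apply: (@leq_ltn_trans (2 ^ 2)) => //; rewrite leq_sqr; lia.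
  apply: (join_second_moment jJ) R10_base_separates.
  by apply/R10_cycleP; rewrite !inE.
have := @leq_bigmax_cond _ (join R10) (fun J : {set 'I_10} => #|J|) _ R10_join013.
by rewrite card_eset.
Qed.

(** * Ear decompositions of R10 *)

Lemma R10_base_circuit l : l \in R10_base -> circuit R10 (eset l).
Proof.
move=> lB; apply: R10_circuit4; first exact: R10_base_cycle.
by apply/eqP; rewrite card_eset; move: l lB; apply/allP.
Qed.

Lemma esetD l l' : eset l :\: eset l' = eset [seq k <- l | k \notin l'].
Proof. by apply/setP=> j; rewrite !inE mem_filter. Qed.

Lemma ear_union_eset ls i : ear_union (map eset ls) i = eset (flatten (take i ls)).
Proof.
rewrite /ear_union -map_take; elim: (take i ls) => [|l ls' IHl] /=.
  by rewrite big_nil; apply/setP=> j; rewrite !inE.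
by rewrite big_cons IHl; apply/setP=> j; rewrite !inE mem_cat.
Qed.

Lemma lobes_eset ls : lobes (map eset ls) =
  [seq eset [seq k <- nth [::] ls i | k \notin flatten (take i ls)] | i <- iota 0 (size ls)].
Proof.
rewrite /lobes size_map; apply/eq_in_map => i; rewrite mem_iota => /= lti.
by rewrite ear_union_eset (nth_map [::]) // esetD.
Qed.

Lemma eset_subset l (S : {set 'I_10}) : all (gtn 10) l ->
  (eset l \subset S) = all (fun k => elt k \in S) l.
Proof.
move/allP=> l10; apply/subsetP/allP => [sS k kl | sS j].
  by apply: sS; rewrite in_eset ?kl //; apply: l10.
by rewrite inE => /sS; rewrite inord_val.
Qed.

(** (E3) for the only nontrivial lobe {3,4,7}: a cycle C whose new elements are
    among 3, 4, 7 avoids 6, 8, 9, and then rows 3 and 4 say that the bits of C at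
    3, 4 and 7 agree, so the lobe of C is empty or the whole of {3,4,7}. *)
Lemma R10_ear_347 : ear R10 (eset [:: 0; 1; 2; 5]) (eset [:: 2; 3; 4; 7]).
Proof.
apply/and3P; split.
- by apply/set0Pn; exists (elt 2); rewrite inE !in_eset.
- by apply/set0Pn; exists (elt 3); rewrite inE !in_eset.
apply/forallP=> C; apply/implyP=> /and3P[/circuitP[cC _ _] _ CD].
rewrite esetD properE; apply: contra CD => /andP[/subsetP sC nsC].
have out k : k < 10 -> k \notin [:: 0; 1; 2; 5] ++ [:: 2; 3; 4; 7] -> (elt k \in C) = false.
  rewrite mem_cat negb_or => k10 /andP[kD kC']; apply/negP=> kC.
  have := sC (elt k); rewrite in_setD kC !in_eset // mem_filter kD (negPf kC').
  by move/(_ isT).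
have [C6 C8 C9] : [/\ (elt 6 \in C) = false, (elt 8 \in C) = false & (elt 9 \in C) = false].
  by split; apply: out.
have /R10_cycleP[_ _ _ C3 C4] := cC.
rewrite C6 C8 addbF /= in C3; rewrite C8 C9 !addbF in C4.
have C7 : (elt 7 \in C) = false.
  apply: contraNF nsC => C7; rewrite eset_subset //=.
  by rewrite !in_setD C3 C4 C7 !in_eset.
apply: contraT => /set0Pn[j jCD]; have /setDP[jC _] := jCD; have := sC j jCD.
move: jC; rewrite inE /= !inE -[X in X \in C]inord_val.
by move=> jC /or3P[] /eqP jE; rewrite jE ?C3 ?C4 C7 in jC.
Qed.

Lemma R10_ear_decomposition : ear_decomposition R10 (map eset R10_base).
Proof.
apply/and4P; split=> //.
- by apply/allP=> _ /mapP[l lB ->]; apply: R10_base_circuit.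
- rewrite ear_union_eset size_map take_size; apply/eqP/setP=> j; rewrite in_setT inE.
  by apply: (allP (isT : all (mem (flatten R10_base)) (iota 0 10))); rewrite mem_iota /=.
apply/forallP; rewrite size_map => -[i lti]; apply/implyP=> i_gt0.
rewrite ear_union_eset (nth_map [::]) //.
have single l l' k : has (mem l) l' -> all (gtn 10) l' -> [seq k <- l' | k \notin l] = [:: k] ->
  ear R10 (eset l) (eset l').
  move=> /hasP[x xl xl'] /allP l10 Ek; apply: ear_of_card1.
    by apply/set0Pn; exists (elt x); rewrite inE !in_eset ?xl //; apply: l10.
  rewrite esetD card_eset Ek.
  have : k \in [:: k] by rewrite inE.
  rewrite -{1}Ek mem_filter => /andP[_ /l10 k10].
  rewrite (@eq_count _ _ (pred1 k)) => [|y]; last by rewrite /= inE.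
  by rewrite count_uniq_mem ?iota_uniq // mem_iota (k10 : k < 10).
case: i lti i_gt0 => [|[|[|[|[|[|i]]]]]] //= _ _.
- exact: R10_ear_347.
- exact: single 6 _ _ _.
- exact: single 8 _ _ _.
- exact: single 9 _ _ _.
Qed.

Lemma R10_base_lobes : odd_lobes (map eset R10_base) = 4 /\ even_lobes (map eset R10_base) = 1.
Proof. by rewrite /odd_lobes /even_lobes lobes_eset /= !card_eset. Qed.

(** The upper bound comes from the length of the ear decomposition above; for the
    lower bound, a cycle among the first five elements vanishes by R10_cycleP. *)
Lemma R10_rank : rank R10 = 5.
Proof.
apply/eqP; rewrite eqn_leq; apply/andP; split.
  by have := ear_rank_le R10_ear_decomposition; rewrite card_ord size_map /=; lia.
have iB : indep R10 (eset (iota 0 5)).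
  apply/col_indepP=> S sS cS; have [_ S0] := R10_cycle_card cS.
  have out k : 4 < k < 10 -> (elt k \in S) = false.
    by case/andP=> k4 k10; apply: contraTF k4 => /(subsetP sS);
      rewrite in_eset ?mem_iota //= -ltnNge.
  apply: contraTeq isT => /S0; rewrite card_ord10 !big_cons !big_nil.
  by have /R10_cycleP[-> -> -> -> ->] := cS; rewrite !out.
by have := @leq_bigmax_cond _ (indep R10) (fun J : {set 'I_10} => #|J|) _ iB; rewrite card_eset.
Qed.

Lemma R10_ear_size s : ear_decomposition R10 s -> size s <= 5.
Proof. by move/ear_rank_le; rewrite R10_rank card_ord; lia. Qed.

Lemma R10_gamma : gamma R10 = 4.
Proof.
have := gamma_ub R10_ear_decomposition; have [-> _] := R10_base_lobes.
have [s es ->] := gamma_attained R10_ear_decomposition.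
have := even_lobes_gt0 R10_circuit_even es; have := odd_even_lobes s.
by have := R10_ear_size es; lia.
Qed.

Lemma R10_phi : phi R10 = 1.
Proof.
have := phi_lb R10_ear_decomposition; have [_ ->] := R10_base_lobes.
have [s es ->] := phi_attained R10_ear_decomposition.
by have := even_lobes_gt0 R10_circuit_even es; lia.
Qed.

Theorem proposition5p4 :
  [/\ mu R10 = 3%N, gamma R10 = 4%N & eta R10 = 3%:R%R]
  /\ (mu R10)%:R%R = eta R10.
Proof.
have etaE : eta R10 = 3%:R%R by rewrite /eta R10_rank R10_phi.
by rewrite etaE R10_mu R10_gamma.
Qed.
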